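(* Let $A=\{a_k\}_{k\in\mathbb{Z}}$ be a sequence of complex numbers with $a_k=o(k^{\alpha})$ as $k\to\pm\infty$ for some $\alpha<1$. Let $p$ and $n$ be positive integers. If $|s+n|<1$, then $$\frac{\Psi^{(p-1)}(-s;A)}{(p-1)!}=(-1)^p\sum_{j=1}^\infty\binom{j+p-2}{p-1}\bar M^{(A)}_n(j+p-1)(s+n)^{j-1}.$$
   Context: The growth condition $a_k=o(k^\alpha)$ is understood with $|k|^\alpha$ for negative $k$. Parametric digamma function: for $s\in\mathbb{C}\setminus\{0,1,2,\dots\}$, $$\Psi(-s;A):=\frac{a_0}{s}+\sum_{k=1}^\infty\left(\frac{a_k}{k}-\frac{a_k}{k-s}\right).$$ $\Psi^{(p-1)}(-s;A)$ denotes the $(p-1)$-th derivative of the function $z\mapsto\Psi(z;A)$ evaluated at $z=-s$. For integers $j\ge1$, $n\ge0$: $\bar E^{(A)}_n(j):=\sum_{k=1}^n \frac{a_{k-n-1}}{k^j}$, $\bar E^{(A)}_0(j):=0$; $\bar F^{(A)}_n(1):=\sum_{k=1}^\infty\frac{a_{k-n}-a_k}{k}$ and $\bar F^{(A)}_n(j):=\sum_{k=1}^\infty\frac{a_{k-n}}{k^j}$ for $j>1$; and for $n\ge1$, $\bar M^{(A)}_n(j):=\bar F^{(A)}_n(j)-\bar E^{(A)}_{n-1}(j)$. *)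

(* Defs.v *)
From HB Require Import structures.
From mathcomp Require Import all_boot all_order all_algebra.
From mathcomp Require Import all_classical all_reals all_analysis.
From mathcomp Require Import complex.

Set Implicit Arguments.
Unset Strict Implicit.
Unset Printing Implicit Defensive.

Import Order.TTheory GRing.Theory Num.Theory.
Import numFieldNormedType.Exports.

Local Open Scope ring_scope.
Local Open Scope complex_scope.
Local Open Scope classical_set_scope.

(* R[i] as a normed module over itself: limits in R[i] are those of the complex
   modulus, and [derive1n] on functions R[i] -> R[i] is the complex
   derivative.  These are the instances that MathComp-Analysis declares for an
   abstract numFieldType, where they do not apply to the concrete R[i]. *)
#[non_forgetful_inheritance]
HB.instance Definition _ (R : realType) := GRing.ComAlgebra.copy R[i] R[i]^o.
#[non_forgetful_inheritance]
HB.instance Definition _ (R : realType) := Vector.copy R[i] R[i]^o.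
#[non_forgetful_inheritance]
HB.instance Definition _ (R : realType) := NormedModule.copy R[i] R[i]^o.

(* MathComp-Analysis defines this notation for extended reals only. *)
Notation "\sum_ ( m <= i '<oo' ) F" :=
  (limn (fun N => \sum_(m <= i < N) F)) : ring_scope.

Definition growth_condition (R : realType) (a : int -> R[i]) (alpha : R) : Prop :=
  (fun k : nat => a k%:Z) =o_\oo (fun k : nat => (k%:R `^ alpha)%:C) /\
  (fun k : nat => a (- k%:Z)) =o_\oo (fun k : nat => (k%:R `^ alpha)%:C).

(* The function z |-> Psi(z; A), with s = - z.  The values at
   z = 0, -1, -2, ..., where Psi is not defined, carry no meaning. *)
Definition Psi (R : realType) (a : int -> R[i]) (z : R[i]) : R[i] :=
  let s := - z in
  a 0 / s + \sum_(1 <= k <oo) (a k%:Z / k%:R - a k%:Z / (k%:R - s)).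

Definition barE (R : realType) (a : int -> R[i]) (n j : nat) : R[i] :=
  \sum_(1 <= k < n.+1) a (k%:Z - n%:Z - 1) / k%:R ^+ j.

(* Both series are limits of partial sums; the one for j = 1 need not converge
   absolutely.  The value at j = 0 carries no meaning. *)
Definition barF (R : realType) (a : int -> R[i]) (n j : nat) : R[i] :=
  if j == 1%N then \sum_(1 <= k <oo) ((a (k%:Z - n%:Z) - a k%:Z) / k%:R)
  else \sum_(1 <= k <oo) (a (k%:Z - n%:Z) / k%:R ^+ j).

(* Only meant for n >= 1. *)
Definition barM (R : realType) (a : int -> R[i]) (n j : nat) : R[i] :=
  barF a n j - barE a n.-1 j.

(* Main.v *)
(* With h = - (s + n), expand 1/(k+n+h) to finite order in h: if
   rho_I = sum_{k >= 0} a_k / ((k+n)^I (k+n+h)), then rho_I = M_n(I+1) - h rho_{I+1}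
   for I >= 1, while - Psi(n+h) = M_n(1) - h rho_1.  The rho_I are bounded by a
   multiple of sum_k |a_k| / (k+1)^2, so the remainder h^I rho_I vanishes and
   Psi(n+h) = sum_i (-1)^(i+1) M_n(i+1) h^i.  The terms of barE cancel exactly the
   terms of barF with negative index, so only (a_k)_{k >= 0} matters.  The power
   series has coefficients bounded by multiples of binomials C(i+q,q), a class
   stable under termwise differentiation, which gives all derivatives. *)
Require Import Defs.
From HB Require Import structures.
From mathcomp Require Import all_boot all_order all_algebra.
From mathcomp Require Import all_classical all_reals all_analysis.
From mathcomp Require Import complex.
From mathcomp Require Import ring zify.

Set Implicit Arguments.
Unset Strict Implicit.
Unset Printing Implicit Defensive.

Import Order.TTheory GRing.Theory Num.Theory.
Import numFieldNormedType.Exports.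

Local Open Scope ring_scope.
Local Open Scope complex_scope.
Local Open Scope classical_set_scope.

(** * Power series with polynomially growing coefficients, and their termwise differentiation *)

Section PowerSeries.
Variable K : numFieldType.
Implicit Types (c u : nat -> K) (h d x z : K).

Lemma norm_cvg_le (u : nat -> K) (l C : K) :
  u @ \oo --> l -> (forall N, `|u N| <= C) -> `|l| <= C.
Proof.
move=> ul uC.
(* The order of [K] is partial: [C] is comparable with [|l|] because it dominates a norm. *)
have Cr : C \is Num.real by apply: ger0_real; apply: le_trans (uC 0%N).
rewrite real_leNgt ?normr_real//; apply/negP => Cl.
have e0 : 0 < (`|l| - C) / 2 by rewrite divr_gt0// subr_gt0.
move/cvgrPdist_lt : ul => /(_ _ e0)[N _ /(_ N (leqnn N))] lN.
have : `|l| < `|l|.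
  rewrite -[X in `|X| < _](subrK (u N)).
  apply: le_lt_trans (ler_normD _ _) _.
  apply: (@lt_le_trans _ _ ((`|l| - C) / 2 + C)); first exact: ltr_leD.
  rewrite -lerBrDr ler_pdivrMr// mulr_natr mulr2n lerDr.
  by rewrite subr_ge0 ltW.
by rewrite ltxx.
Qed.

(** Multiplying the remainder for [i] by [h + d] gives the one for [i.+1] up to [i * d^2 * h^(i-1)];
    Pascal's rule C(i+1,2) = C(i,2) + i absorbs this term. Where [i - 2] truncates, the binomial is
    0. *)
Lemma norm_power_remainder_le (h d r : K) i : `|h| <= r -> `|h + d| <= r ->
  `|(h + d) ^+ i - h ^+ i - d * (h ^+ i.-1 *+ i)|
    <= `|d| ^+ 2 * ('C(i, 2)%:R * r ^+ (i - 2)).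
Proof.
move=> hr hdr; have r0 : 0 <= r by apply: le_trans hr.
elim: i => [|i IH]; first by rewrite !expr0 mulr0n mulr0 !subrr normr0 mul0r mulr0.
have -> : (h + d) ^+ i.+1 - h ^+ i.+1 - d * (h ^+ i.+1.-1 *+ i.+1) =
    (h + d) * ((h + d) ^+ i - h ^+ i - d * (h ^+ i.-1 *+ i))
    + d ^+ 2 * (h ^+ i.-1 *+ i).
  case: i {IH} => [|i] /=; first by rewrite !expr0 !expr1 !mulr0n; ring.
  by rewrite !exprS -[_ *+ i.+2]mulr_natr -[_ *+ i.+1]mulr_natr -(natr1 i.+1); ring.
apply: le_trans (ler_normD _ _) _.
have -> : 'C(i.+1, 2)%:R * r ^+ (i.+1 - 2) =
    r * ('C(i, 2)%:R * r ^+ (i - 2)) + r ^+ i.-1 *+ i.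
  rewrite binS bin1 natrD; case: i {IH} => [|[|i]].
  - by rewrite bin_small// addr0 !mul0r mulr0 mulr0n addr0.
  - by rewrite bin_small// mul0r mulr0 !add0r mul1r.
  - by rewrite !subSS !subn0 /= exprS -mulr_natr; ring.
rewrite [X in _ <= X]mulrDr; apply: lerD.
  by rewrite normrM mulrCA; apply: ler_pM.
by rewrite normrM normrX ler_wpM2l ?exprn_ge0// normrMn normrX lerMn2r lerXn2r ?orbT// nnegrE.
Qed.

(** Multiplying the partial sum for [q.+1] by [1 - r] gives the one for [q], up to the nonnegative
    boundary term C(N+q,q+1) r^N. *)
Lemma sum_bin_geometric_le (r : K) q N : 0 <= r -> r < 1 ->
  \sum_(0 <= i < N) 'C(i + q, q)%:R * r ^+ i <= (1 - r) ^- q.+1.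
Proof.
move=> r0 r1; have r1' : 0 < 1 - r by rewrite subr_gt0.
elim: q => [|q IH].
  have -> : \sum_(0 <= i < N) 'C(i + 0, 0)%:R * r ^+ i = \sum_(i < N) r ^+ i.
    by rewrite big_mkord; apply: eq_bigr => i _; rewrite bin0 mul1r.
  rewrite expr1 -[leRHS]mul1r ler_pdivlMr// mulrC -opprB mulNr -subrX1 opprB.
  by rewrite lerBlDr lerDl exprn_ge0.
rewrite exprS invfM mulrC ler_pdivlMr// mulrC; apply: le_trans IH.
have <- : (1 - r) * (\sum_(0 <= i < N) 'C(i + q.+1, q.+1)%:R * r ^+ i)
     + 'C(N + q, q.+1)%:R * r ^+ N = \sum_(0 <= i < N) 'C(i + q, q)%:R * r ^+ i.
  elim: N => [|N IH]; first by rewrite !big_geq// add0n bin_small// mul0r mulr0 addr0.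
  rewrite !big_nat_recr//= -IH addSn binS addnS binS natrD exprS; ring.
by rewrite lerDl mulr_ge0// exprn_ge0.
Qed.

Definition pseries_sum c h : K := limn (fun N => \sum_(0 <= i < N) c i * h ^+ i).
Definition dcoef c : nat -> K := fun i => c i.+1 *+ i.+1.

Lemma dcoef_iter c m i : iter m dcoef c i = c (i + m)%N *+ ('C(i + m, m) * m`!).
Proof.
elim: m i => [|m IH] i; first by rewrite /= bin0 addn0.
rewrite iterS {1}/dcoef IH -mulrnA addSnnS; congr (_ *+ _).
by rewrite !bin_ffact addnS ffactnSr subSn ?leq_addl// addnK.
Qed.

Definition binomially_bounded c :=
  exists B q, 0 <= B /\ forall i, `|c i| <= B * 'C(i + q, q)%:R.

(** From (i+1) C(i+1+q,q) = (q+1) C(i+1+q,q+1). *)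
Lemma binomially_bounded_dcoef c :
  binomially_bounded c -> binomially_bounded (dcoef c).
Proof.
move=> [B [q [B0 cB]]]; exists (B * q.+1%:R), q.+1; split; first exact: mulr_ge0.
move=> i; rewrite /dcoef normrMn -mulrA -natrM addnS -addSn mul_bin_left.
by rewrite addnK natrM mulrCA -[leLHS]mulr_natl ler_wpM2l.
Qed.

Lemma binomially_bounded_iter c m :
  binomially_bounded c -> binomially_bounded (iter m dcoef c).
Proof. by move=> cb; elim: m => [|m IH] //=; exact: binomially_bounded_dcoef. Qed.

(** Completeness of [K] enters only through this assumption, which [abs_cvg_complex] discharges for
    [R[i]]. *)
Hypothesis abs_cvg : forall u C, (forall N, \sum_(0 <= i < N) `|u i| <= C) ->
  cvgn (fun N => \sum_(0 <= i < N) u i).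

Lemma expr_cvg0 (h : K) : `|h| < 1 -> (fun i => h ^+ i) @ \oo --> (0 : K).
Proof.
move=> h1; apply: (@cvg_series_cvg_0 K K^o).
apply: (abs_cvg (C := (1 - `|h|) ^- 1)) => N.
rewrite -[leRHS]/((1 - `|h|) ^- 1) -(expr1 (1 - `|h|)).
apply: le_trans (sum_bin_geometric_le 0 N (normr_ge0 h) h1).
by apply: ler_sum => i _; rewrite bin0 mul1r normrX.
Qed.

Lemma pseries_cvg c h : binomially_bounded c -> `|h| < 1 ->
  (fun N => \sum_(0 <= i < N) c i * h ^+ i) @ \oo --> pseries_sum c h.
Proof.
move=> [B [q [B0 cB]]] h1.
apply: (abs_cvg (C := B * (1 - `|h|) ^- q.+1)) => N.
apply: le_trans (ler_wpM2l B0 (sum_bin_geometric_le q N (normr_ge0 h) h1)).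
rewrite mulr_sumr; apply: ler_sum => i _.
by rewrite normrM normrX mulrA ler_wpM2r// exprn_ge0.
Qed.

(** Summing the remainders of the single powers: C(i+q,q) C(i,2) = C(q+2,2) C(i+q,q+2) turns the
    bound into the series of (1-r)^-(q+3), so [D] does not depend on [d]. *)
Lemma pseries_sum_remainder_le c h r : binomially_bounded c -> `|h| <= r -> r < 1 ->
  exists D, 0 <= D /\ forall d, `|h + d| <= r ->
    `|pseries_sum c (h + d) - pseries_sum c h - d * pseries_sum (dcoef c) h|
      <= `|d| ^+ 2 * D.
Proof.
move=> cb hr r1; have r0 : 0 <= r by apply: le_trans hr.
have [B [q [B0 cB]]] := cb.
exists (B * 'C(q.+2, 2)%:R * (1 - r) ^- q.+3); split.
  by rewrite !mulr_ge0// invr_ge0 exprn_ge0// subr_ge0 ltW.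
move=> d hdr.
(* The derivative series is cut one term earlier, since [dcoef] shifts the index by one. *)
have F : (fun N => \sum_(0 <= i < N.+1) c i * (h + d) ^+ i
    - \sum_(0 <= i < N.+1) c i * h ^+ i
    - d * \sum_(0 <= i < N) dcoef c i * h ^+ i) @ \oo -->
    (pseries_sum c (h + d) - pseries_sum c h - d * pseries_sum (dcoef c) h).
  apply: cvgB; first apply: cvgB.
  - by rewrite (cvg_shiftS (fun N => \sum_(0 <= i < N) c i * (h + d) ^+ i));
      apply: pseries_cvg => //; apply: le_lt_trans r1.
  - by rewrite (cvg_shiftS (fun N => \sum_(0 <= i < N) c i * h ^+ i));
      apply: pseries_cvg => //; apply: le_lt_trans r1.
  - apply: cvgMr; apply: pseries_cvg; last exact: le_lt_trans r1.
    exact: binomially_bounded_dcoef.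
apply: (norm_cvg_le F) => N.
have -> : \sum_(0 <= i < N.+1) c i * (h + d) ^+ i
    - \sum_(0 <= i < N.+1) c i * h ^+ i
    - d * \sum_(0 <= i < N) dcoef c i * h ^+ i =
    \sum_(0 <= i < N.+1) c i * ((h + d) ^+ i - h ^+ i - d * (h ^+ i.-1 *+ i)).
  rewrite -[X in _ - d * X]add0r.
  have -> : 0 + \sum_(0 <= i < N) dcoef c i * h ^+ i =
      \sum_(0 <= i < N.+1) c i * (h ^+ i.-1 *+ i).
    rewrite [RHS]big_nat_recl//= mulr0n mulr0; congr (_ + _).
    by apply: eq_bigr => i _; rewrite /dcoef mulrnAl mulrnAr.
  rewrite mulr_sumr -!sumrB; apply: eq_bigr => i _; ring.
apply: le_trans (ler_norm_sum _ _ _) _.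
apply: (@le_trans _ _ (\sum_(0 <= i < N.+1)
   `|d| ^+ 2 * (B * 'C(q.+2, 2)%:R) * ('C(i + q, q.+2)%:R * r ^+ (i - 2)))).
  apply: ler_sum => i _; rewrite normrM.
  apply: le_trans (ler_pM (normr_ge0 _) (normr_ge0 _) (cB i)
    (norm_power_remainder_le i hr hdr)) _.
  rewrite le_eqVlt; apply/orP; left; apply/eqP.
  have : ('C(i + q, q) * 'C(i, 2) = 'C(q.+2, 2) * 'C(i + q, q.+2))%N.
    case: (ltnP i 2) => i2.
      by rewrite (bin_small i2) muln0 (@bin_small (i + q)) ?muln0//; lia.
    have E1 := bin_fact (leq_addl i q); have E2 := bin_fact i2.
    have E3 : (q.+2 <= i + q)%N by lia.
    have E3' := bin_fact E3; have E4 := @bin_fact q.+2 2 isT.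
    have G : (0 < q`! * 2`! * (i - 2)`!)%N by rewrite !muln_gt0 !fact_gt0.
    apply/eqP; rewrite -(eqn_pmul2r G); apply/eqP.
    rewrite addnK in E1; rewrite subSS subSS subn0 in E4.
    have X : (i + q - q.+2 = i - 2)%N by lia.
    rewrite X in E3'.
    transitivity ((i + q)`!); [rewrite -E1 -E2|rewrite -E3' -E4]; ring.
  move=> /(congr1 (fun k => k%:R : K)); rewrite !natrM => E.
  transitivity (B * `|d| ^+ 2 * r ^+ (i - 2) * ('C(i + q, q)%:R * 'C(i, 2)%:R)); first by ring.
  rewrite E; ring.
rewrite -mulr_sumr -[leRHS]mulrA mulrA [X in _ <= X]mulrA.
apply: ler_wpM2l; first by rewrite !mulr_ge0// exprn_ge0.
(* The terms [i = 0, 1] vanish, and shifting the rest by two leaves [N.-1] terms. *)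
apply: le_trans (sum_bin_geometric_le q.+2 N.-1 r0 r1).
case: N {F} => [|N]; first by rewrite big_nat1 big_geq// bin_small ?mul0r.
rewrite big_nat_recl//= big_nat_recl//= !bin_small ?add0n// ?add1n// !mul0r !add0r.
by apply: ler_sum => i _; rewrite -addSnnS -addSnnS subSS subSS subn0.
Qed.

(** The midpoint [r] of [|h|] and 1 leaves room for small [d]; the quadratic remainder makes the
    error of the difference quotient at most [|d| * D]. *)
Lemma derive1_pseries_sum (f : K -> K) (x0 : K) c : binomially_bounded c ->
  (forall z, `|z - x0| < 1 -> f z = pseries_sum c (z - x0)) ->
  forall z, `|z - x0| < 1 -> derive1 f z = pseries_sum (dcoef c) (z - x0).
Proof.
move=> cb fE z z1; pose h := z - x0; pose r := (1 + `|h|) / 2.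
have hr : `|h| < r by rewrite ltr_pdivlMr// mulrDr mulr1 ltrD2r.
have r1 : r < 1 by rewrite ltr_pdivrMr// mul1r -[2]/(1 + 1 : K) ltrD2l.
have [D [D0 HD]] := pseries_sum_remainder_le cb (ltW hr) r1.
apply/cvg_lim => //; apply/cvgrPdist_le => e e0; near=> d.
have d0 : d != 0 by near: d; exact: nbhs_dnbhs_neq.
have hdr : `|h + d| <= r.
  apply: le_trans (ler_normD _ _) _; rewrite -lerBrDl ltW//.
  by near: d; apply: dnbhs0_lt; rewrite subr_gt0.
have dD : `|d| <= e / (D + 1).
  by near: d; apply: dnbhs0_le; rewrite divr_gt0// ltr_wpDl.
rewrite fE; last by rewrite -addrA addrC; apply: le_lt_trans r1.
have -> : d + z - x0 = h + d by rewrite /h addrC [d + z]addrC addrA [- _ + _]addrC.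
have nd : 0 < `|d| by rewrite normr_gt0.
rewrite (fE z)// -/h distrC.
change (`|d^-1 * (pseries_sum c (h + d) - pseries_sum c h)
  - pseries_sum (dcoef c) h| <= e).
rewrite -(ler_pM2l nd) -normrM mulrBr mulrA divff// mul1r.
apply: le_trans (HD _ hdr) _; rewrite expr2 -mulrA ler_pM2l//.
apply: (@le_trans _ _ (`|d| * (D + 1))); first by rewrite ler_wpM2l// lerDl.
by rewrite -ler_pdivlMr// ltr_wpDl.
Unshelve. all: by end_near. Qed.

Lemma derive1n_pseries_sum (f : K -> K) (x0 : K) c m : binomially_bounded c ->
  (forall z, `|z - x0| < 1 -> f z = pseries_sum c (z - x0)) ->
  forall z, `|z - x0| < 1 -> derive1n m f z = pseries_sum (iter m dcoef c) (z - x0).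
Proof.
move=> cb fE; elim: m => [|m IH] //= z z1.
by apply: derive1_pseries_sum => //; exact: binomially_bounded_iter.
Qed.

(** * Expansion of the digamma series about [n], for coefficients with nonnegative index *)

Section Digamma.
Variables (a : nat -> K) (C : K) (n : nat).
Hypothesis n0 : (0 < n)%N.
Hypothesis a_summable : forall N, \sum_(0 <= m < N) `|a m| / m.+1%:R ^+ 2 <= C.

(** Comparison test behind all the series below; its bound on the limit later supplies uniformity in
    [j] and in [I]. *)
Lemma quadratic_weight_cvg (g : nat -> K) B : 0 <= B ->
  (forall m, `|g m| <= B / m.+1%:R ^+ 2) ->
  let S N := \sum_(0 <= m < N) a m * g m in
  S @ \oo --> limn S /\ `|limn S| <= B * C.
Proof.
move=> B0 gB S.
have SC N : \sum_(0 <= m < N) `|a m * g m| <= B * C.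
  apply: le_trans (ler_wpM2l B0 (a_summable N)).
  rewrite mulr_sumr; apply: ler_sum => m _.
  by rewrite normrM mulrCA ler_wpM2l.
have cS : S @ \oo --> limn S by exact: abs_cvg SC.
split=> //; apply: (norm_cvg_le cS) => N.
exact: le_trans (ler_norm_sum _ _ _) (SC N).
Qed.

Lemma shifted_ge m : m.+1%:R <= (m + n)%:R :> K.
Proof. by rewrite ler_nat -addn1 leq_add2l. Qed.

(** Since m + n >= m + 1 and j >= 2, the weight is at most 1/(m+1)^2. The bound is the same for all
    [j], which makes the Taylor coefficients bounded. *)
Lemma moment_cvg j : (1 < j)%N ->
  let S N := \sum_(0 <= m < N) a m / (m + n)%:R ^+ j in
  S @ \oo --> limn S /\ `|limn S| <= C.
Proof.
move=> j1; rewrite -[C]mul1r; apply: quadratic_weight_cvg => // m.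
rewrite mul1r ger0_norm ?invr_ge0 ?exprn_ge0//.
have X0 : 0 < (m + n)%:R :> K by apply: lt_le_trans (shifted_ge m).
rewrite lef_pV2 ?posrE ?exprn_gt0//.
apply: (@le_trans _ _ ((m + n)%:R ^+ 2)).
  by rewrite lerXn2r ?nnegrE// shifted_ge.
by rewrite -natrX -natrX ler_nat leq_pexp2l// addn_gt0 n0 orbT.
Qed.

(* The term [m = 0] of the second sum is [a 0 / 0 = 0]. *)
Lemma first_moment_cvg :
  let S N := \sum_(0 <= m < N) a m / (m + n)%:R - \sum_(0 <= m < N) a m / m%:R in
  S @ \oo --> limn S.
Proof.
move=> S; suff : cvgn S by [].
have -> : S = fun N => \sum_(0 <= m < N) a m * ((m + n)%:R^-1 - m%:R^-1).
  by apply/funext => N; rewrite /S -sumrB; apply: eq_bigr => m _; rewrite mulrBr.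
have B0 : 0 <= 2 * n%:R :> K by rewrite mulr_ge0.
(* For m >= 1 the absolute value is n/(m(m+n)), and (m+1)^2 <= 2m(m+n); at m = 0 it is 1/n. *)
suff H m : `|(m + n)%:R^-1 - m%:R^-1| <= 2 * n%:R / m.+1%:R ^+ 2 :> K.
  exact: (quadratic_weight_cvg B0 H).1.
case: m => [|m].
  rewrite add0n invr0 subr0 expr1n invr1 mulr1 ger0_norm ?invr_ge0//.
  apply: (@le_trans _ _ 1); first by rewrite invf_le1 ?ltr0n// ler1n.
  by rewrite -natrM ler1n muln_gt0.
rewrite distrC.
have x0 : m.+1%:R != 0 :> K by rewrite pnatr_eq0.
have y0 : (m.+1 + n)%:R != 0 :> K by rewrite pnatr_eq0.
have -> : m.+1%:R^-1 - (m.+1 + n)%:R^-1 = n%:R / (m.+1%:R * (m.+1 + n)%:R) :> K.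
  have -> : n%:R = (m.+1 + n)%:R - m.+1%:R :> K by rewrite natrD addrAC subrr add0r.
  move: m.+1%:R (m.+1 + n)%:R x0 y0 => x y x0 y0; field.
  by rewrite y0.
rewrite ger0_norm ?mulr_ge0// ?invr_ge0 -?natrM//.
rewrite ler_pdivrMr ?ltr0n ?muln_gt0// mulrAC ler_pdivlMr ?exprn_gt0//.
rewrite -natrX -!natrM ler_nat; nia.
Qed.

(** Here [n%:R + h] stands for [- s], and [M] is any family of limits, later [barM]. *)
Lemma digamma_expansion (M : nat -> K) (h : K) : `|h| < 1 ->
  (fun N => \sum_(0 <= m < N) a m / (m + n)%:R - \sum_(0 <= m < N) a m / m%:R)
    @ \oo --> M 1%N ->
  (forall j, (1 < j)%N ->
    (fun N => \sum_(0 <= m < N) a m / (m + n)%:R ^+ j) @ \oo --> M j) ->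
  a 0%N / - (n%:R + h)
    + limn (fun N => \sum_(1 <= k < N) (a k / k%:R - a k / (k%:R + (n%:R + h))))
  = pseries_sum (fun i => - (-1) ^+ i * M i.+1) h.
Proof.
move=> h1 Q M2; pose X m : K := (m + n)%:R.
have h1' : 0 < 1 - `|h| by rewrite subr_gt0.
have X0 m : 0 < X m by apply: lt_le_trans (shifted_ge m).
(* From m + 1 - |h| >= (m+1)(1-|h|): no denominator vanishes, and all grow linearly in [m]. *)
have Xh m : m.+1%:R * (1 - `|h|) <= `|X m + h|.
  apply: le_trans (lerB_normD _ _); rewrite (ger0_norm (ltW (X0 m))).
  apply: (@le_trans _ _ (m.+1%:R - `|h|)); last by rewrite lerD2r shifted_ge.
  by rewrite mulrBr mulr1 lerD2l lerN2 ler_peMl// ler1n.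
have Xh0 m : X m + h != 0.
  by rewrite -normr_gt0; apply: lt_le_trans (Xh m); rewrite mulr_gt0.
(* One factor m + 1 comes from [X m ^+ I], hence [0 < I], and the other from [Xh]. *)
have gB I : (0 < I)%N -> forall m,
    `|(X m ^+ I * (X m + h))^-1| <= (1 - `|h|)^-1 / m.+1%:R ^+ 2.
  move=> I0 m; rewrite normfV -invfM lef_pV2 ?posrE; last 2 first.
  - by rewrite normr_gt0 mulf_neq0// expf_neq0// gt_eqF.
  - by rewrite mulr_gt0// exprn_gt0.
  rewrite normrM normrX (ger0_norm (ltW (X0 m))) expr2 mulrCA.
  apply: ler_pM => //; [by rewrite mulr_ge0// ltW| |by rewrite mulrC].
  apply: (le_trans (shifted_ge m)); rewrite -natrX ler_nat.
  by rewrite -[leqLHS]expn1 leq_pexp2l// addn_gt0 n0 orbT.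
pose S I N := \sum_(0 <= m < N) a m * (X m ^+ I * (X m + h))^-1.
have h1V : 0 <= (1 - `|h|)^-1 by rewrite invr_ge0 ltW.
have Sc I : (0 < I)%N -> S I @ \oo --> limn (S I).
  by move=> I0; have [] := quadratic_weight_cvg h1V (gB I I0).
have SC I : (0 < I)%N -> `|limn (S I)| <= (1 - `|h|)^-1 * C.
  by move=> I0; have [] := quadratic_weight_cvg h1V (gB I I0).
(* Termwise, 1/(x^I (x+h)) = 1/x^(I+1) - h/(x^(I+1) (x+h)). *)
have Srec I : (0 < I)%N -> limn (S I) = M I.+1 - h * limn (S I.+1).
  move=> I0; apply/cvg_lim => //.
  have -> : S I = fun N => \sum_(0 <= m < N) a m / X m ^+ I.+1 - h * S I.+1 N.
    apply/funext => N; rewrite /S mulr_sumr -sumrB; apply: eq_bigr => m _.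
    have := expf_neq0 I (lt0r_neq0 (X0 m)); rewrite exprS.
    move: (X m) (X m ^+ I) (lt0r_neq0 (X0 m)) (Xh0 m) => x y x0 xh y0.
    by field; rewrite xh y0 x0.
  by apply: cvgB; [exact: M2|apply: cvgMr; exact: Sc].
(* The same recursion at level [I = 0], where subtracting [a m / m%:R] is what ensures
   convergence. *)
pose L := M 1%N - h * limn (S 1%N).
have PL : (fun N => \sum_(0 <= m < N) (a m / (X m + h) - a m / m%:R)) @ \oo --> L.
  suff -> : (fun N => \sum_(0 <= m < N) (a m / (X m + h) - a m / m%:R)) =
     (fun N => (\sum_(0 <= m < N) a m / (m + n)%:R - \sum_(0 <= m < N) a m / m%:R)
       - h * S 1%N N).
    by apply: cvgB => //; apply: cvgMr; exact: Sc.
  apply/funext => N; rewrite /S mulr_sumr -!sumrB; apply: eq_bigr => m _.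
  suff -> : a m / (X m + h) = a m / X m - h * (a m * (X m ^+ 1 * (X m + h))^-1).
    by rewrite /X addrAC.
  move: (X m) (lt0r_neq0 (X0 m)) (Xh0 m) => x x0 xh; rewrite expr1.
  by field; rewrite xh.
(* The sum over [k] lacks the term [m = 0] of [PL], which is [a 0 / (n + h)] because [a 0 / 0 = 0];
   it will cancel the isolated first term of the digamma function. *)
have -> : limn (fun N => \sum_(1 <= k < N) (a k / k%:R - a k / (k%:R + (n%:R + h))))
    = a 0%N / (n%:R + h) - L.
  apply/cvg_lim => //; rewrite -cvg_shiftS.
  have -> : (fun N => \sum_(1 <= k < N.+1) (a k / k%:R - a k / (k%:R + (n%:R + h))))
    = fun N => a 0%N / (n%:R + h)
       - \sum_(0 <= m < N.+1) (a m / (X m + h) - a m / m%:R).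
    apply/funext => N; rewrite [in RHS]big_nat_recl// /X add0n invr0 mulr0 subr0.
    rewrite opprD addNKr big_add1 /= -sumrN; apply: eq_bigr => m _.
    by rewrite opprB natrD addrA.
  apply: cvgB; first exact: cvg_cst.
  by rewrite (cvg_shiftS (fun N => \sum_(0 <= m < N) (a m / (X m + h) - a m / m%:R))).
rewrite invrN mulrN addKr; symmetry; apply/cvg_lim => //.
rewrite -cvg_shiftS.
(* The iterated recursion, with its exact remainder. *)
have -> : (fun N => \sum_(0 <= i < N.+1) - (-1) ^+ i * M i.+1 * h ^+ i) =
    fun N => - L + (- h) ^+ N.+1 * limn (S N.+1).
  apply/funext; elim=> [|N IH].
    rewrite big_nat1 /L !expr0 expr1. ring.
  rewrite big_nat_recr//= IH (Srec N.+1)// [(- h) ^+ N.+2]exprS [(- h) ^+ N.+1]exprNn.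
  ring.
(* [SC] bounds [limn (S I)] independently of [I], so the factor [(- h) ^+ N.+1] sends the remainder
   to 0. *)
suff R0 : (fun N => (- h) ^+ N.+1 * limn (S N.+1)) @ \oo --> (0 : K).
  by have := cvgD (cvg_cst (- L)) R0; rewrite addr0; apply.
apply/cvgrPdist_le => e e0.
have hN : `|- h| < 1 by rewrite normrN.
have B0 : 0 <= (1 - `|h|)^-1 * C by apply: le_trans (SC 1%N isT).
have B1 : 0 < (1 - `|h|)^-1 * C + 1 by rewrite ltr_wpDl.
have := expr_cvg0 hN; rewrite -cvg_shiftS => /cvgrPdist_le /(_ (e / ((1 - `|h|)^-1 * C + 1))).
rewrite divr_gt0// => /(_ isT); apply: filterS => N.
rewrite !sub0r !normrN => E.
rewrite normrM; apply: (@le_trans _ _ (e / ((1 - `|h|)^-1 * C + 1) * ((1 - `|h|)^-1 * C + 1))).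
  by apply: ler_pM => //; apply: le_trans (SC _ _) _ => //; rewrite lerDl.
by rewrite divfK// gt_eqF.
Qed.
End Digamma.
End PowerSeries.

(** * Splitting the series of [barF] into nonnegative and negative indices *)

Section Moments.
Variables (K : numFieldType) (b : int -> K) (n : nat).
Hypothesis n0 : (0 < n)%N.

Lemma sum_shift j N : \sum_(1 <= k < N + n) b (k%:Z - n%:Z) / k%:R ^+ j =
  \sum_(0 <= m < N) b m%:Z / (m + n)%:R ^+ j
    + \sum_(1 <= k < n) b (k%:Z - n%:Z) / k%:R ^+ j.
Proof.
rewrite (big_cat_nat (n := n))//= ?leq_addl// addrC; congr (_ + _).
rewrite -{1}[n]add0n big_addn addnK; apply: eq_bigr => m _.
by rewrite PoszD addrK.
Qed.

Lemma barF_cvg j l :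
  (fun N => \sum_(0 <= m < N) b m%:Z / (m + n)%:R ^+ j) @ \oo --> l ->
  (fun N => \sum_(1 <= k < N) b (k%:Z - n%:Z) / k%:R ^+ j) @ \oo -->
    l + \sum_(1 <= k < n) b (k%:Z - n%:Z) / k%:R ^+ j.
Proof.
move=> bl; rewrite -(cvg_shiftn n).
rewrite /= (funext (sum_shift j)); apply: cvgD => //; exact: cvg_cst.
Qed.

(** The two halves need not converge separately. Up to [N + n], the shifted half involves [b] at
    nonnegative indices below [N] only, the other half up to [N + n]: the [n] leftover terms
    [b k / k] tend to 0. *)
Lemma barF1_cvg l : (fun k : nat => b k%:Z / k%:R) @ \oo --> (0 : K) ->
  (fun N => \sum_(0 <= m < N) b m%:Z / (m + n)%:R
          - \sum_(0 <= m < N) b m%:Z / m%:R) @ \oo --> l ->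
  (fun N => \sum_(1 <= k < N) (b (k%:Z - n%:Z) - b k%:Z) / k%:R) @ \oo -->
    l + \sum_(1 <= k < n) b (k%:Z - n%:Z) / k%:R.
Proof.
move=> b0 bl; rewrite -(cvg_shiftn n).
have tail m : (fun N => \sum_(0 <= i < m) b (i + N)%N%:Z / (i + N)%:R) @ \oo --> (0 : K).
  elim: m => [|m IH].
    have -> : (fun N => \sum_(0 <= i < 0) b (i + N)%N%:Z / (i + N)%:R) = cst (0 : K).
      by apply/funext => N; rewrite big_geq.
    exact: cvg_cst.
  have -> : (fun N => \sum_(0 <= i < m.+1) b (i + N)%N%:Z / (i + N)%:R) =
      fun N => \sum_(0 <= i < m) b (i + N)%N%:Z / (i + N)%:R + b (N + m)%N%:Z / (N + m)%:R.
    by apply/funext => N; rewrite big_nat_recr//= [(m + N)%N]addnC.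
  suff /(cvgD IH) : (fun N => b (N + m)%N%:Z / (N + m)%:R) @ \oo --> (0 : K).
    by rewrite addr0; apply.
  by rewrite (cvg_shiftn m (fun k : nat => b k%:Z / k%:R)).
have -> : (fun N => \sum_(1 <= k < N + n) (b (k%:Z - n%:Z) - b k%:Z) / k%:R) =
    fun N => (\sum_(0 <= m < N) b m%:Z / (m + n)%:R - \sum_(0 <= m < N) b m%:Z / m%:R)
     + \sum_(1 <= k < n) b (k%:Z - n%:Z) / k%:R
     - \sum_(0 <= i < n) b (i + N)%N%:Z / (i + N)%:R.
  apply/funext => N.
  transitivity (\sum_(1 <= k < N + n) b (k%:Z - n%:Z) / k%:R ^+ 1
     - \sum_(0 <= k < N + n) b k%:Z / k%:R).
    rewrite (big_ltn (m := 0))// ?addn_gt0 ?n0 ?orbT// invr0 mulr0 add0r.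
    by rewrite -sumrB; apply: eq_bigr => k _; rewrite mulrBl.
  rewrite sum_shift [X in _ - X = _](big_cat_nat (n := N))//= ?leq_addr//.
  have -> : \sum_(N <= k < N + n) b k%:Z / k%:R =
      \sum_(0 <= i < n) b (i + N)%N%:Z / (i + N)%:R.
    by rewrite -{1}[N]add0n big_addn addKn.
  under eq_bigr do rewrite expr1.
  under [X in _ + X - _]eq_bigr do rewrite expr1.
  ring.
rewrite -[l + _]subr0; apply: cvgB => //.
by apply: cvgD => //; exact: cvg_cst.
Qed.
End Moments.

Lemma lim_eq (K : numFieldType) (u : nat -> K) (l : K) : u @ \oo --> l -> limn u = l.
Proof. by move/cvg_lim; apply. Qed.

Lemma cvg_add_scaled (K : numFieldType) (u v : nat -> K) (l m z : K) :
  u @ \oo --> l -> v @ \oo --> m -> (fun N => u N + z * v N) @ \oo --> l + z * m.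
Proof. by move=> ul vm; apply: cvgD => //; apply: cvgMr. Qed.

(** Handles at once a constant factor and the offset between sums starting at 1 and at 0. *)
Lemma cvg_scaled_shiftS (K : numFieldType) (u v : nat -> K) (l z : K) :
  u @ \oo --> l -> (forall N, v N.+1 = z * u N) -> v @ \oo --> z * l.
Proof. by move=> ul vE; rewrite -cvg_shiftS (funext vE); apply: cvgMr. Qed.

(** * Absolute convergence in [R[i]], and summability from the growth condition *)

Section Complex.
Variable R : realType.

Lemma real_complex_cvg (u : nat -> R) (l : R) : u @ \oo --> l ->
  (fun k => (u k)%:C) @ \oo --> l%:C.
Proof.
move=> ul; apply/cvgrPdist_le => e e0.
have [d ed] : exists d, e = d%:C.
  by exists (complex.Re e); rewrite RRe_real// ger0_real// ltW.
move: e0; rewrite ed ltcR => d0.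
move/cvgrPdist_le : ul => /(_ _ d0); apply: filterS => k.
by rewrite -rmorphB /= normc_def /= expr0n addr0 sqrtr_sqr lecR.
Qed.

Lemma abs_cvg_real (x : nat -> R) C : (forall N, \sum_(0 <= i < N) `|x i| <= C) ->
  cvgn (fun N => \sum_(0 <= i < N) x i).
Proof.
move=> xC; apply: (@normed_cvg R R^o x).
apply: nondecreasing_is_cvgn.
  apply/nondecreasing_seqP => N.
  change (\sum_(0 <= i < N) `|x i| <= \sum_(0 <= i < N.+1) `|x i|).
  by rewrite big_nat_recr//= lerDl.
by exists C => _ [N _ <-]; exact: xC.
Qed.

Lemma abs_cvg_complex (u : nat -> R[i]) C :
  (forall N, \sum_(0 <= i < N) `|u i| <= C) -> cvgn (fun N => \sum_(0 <= i < N) u i).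
Proof.
move=> uC.
have C0 : 0 <= C by have := uC 0%N; rewrite big_geq.
have [c Cc] : exists c, C = c%:C by exists (complex.Re C); rewrite RRe_real// ger0_real.
have part (f : R[i] -> R) : (forall z, `|f z|%:C <= `|z|) ->
    cvgn (fun N => \sum_(0 <= i < N) f (u i)).
  move=> fle; apply: (@abs_cvg_real _ c) => N; rewrite -lecR -Cc.
  by apply: le_trans (uC N); rewrite rmorph_sum; apply: ler_sum => i _; exact: fle.
have /real_complex_cvg re : cvgn (fun N => \sum_(0 <= i < N) complex.Re (u i)).
  by apply: part => z; exact: normc_ge_Re.
have /real_complex_cvg im : cvgn (fun N => \sum_(0 <= i < N) complex.Im (u i)).
  (* The imaginary part is minus the real part of [z * 'i], and this product has the modulus of
     [z]. *)
  apply: part => z; have := normc_ge_Re (z * 'i%C).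
  by rewrite ReiNIm normrN normrM [`|'i%C|]normc_def /= expr0n expr1n add0r sqrtr1 mulr1.
suff -> : (fun N => \sum_(0 <= i < N) u i) =
    fun N => (\sum_(0 <= i < N) complex.Re (u i))%:C
      + 'i%C * (\sum_(0 <= i < N) complex.Im (u i))%:C.
  exact: cvgP (cvg_add_scaled re im).
apply/funext => N; rewrite !rmorph_sum mulr_sumr -big_split /=.
by apply: eq_bigr => i _; exact: complexE.
Qed.

(** A discrete integral test, (k+1)^(-1-e) <= (k^-e - (k+1)^-e)/e, from exp x >= 1 + x and
    ln((k+1)/k) >= 1/(k+1). *)
Lemma telescoping_power_le (e : R) k : 0 < e -> (0 < k)%N ->
  expR (- e * ln k.+1%:R) / k.+1%:R <=
  e^-1 * (expR (- e * ln k%:R) - expR (- e * ln k.+1%:R)).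
Proof.
move=> e0 k0; have k0' : 0 < k%:R :> R by rewrite ltr0n.
have -> : expR (- e * ln k%:R) =
    expR (e * (ln k.+1%:R - ln k%:R)) * expR (- e * ln k.+1%:R).
  by rewrite -expRD; congr expR; ring.
set X := expR (- e * _); set Z := expR (e * _).
have -> : e^-1 * (Z * X - X) = X * (e^-1 * (Z - 1)) by ring.
rewrite ler_pM2l ?expR_gt0// mulrC ler_pdivlMr// lerBrDl.
apply: le_trans (expR_ge1Dx _); rewrite lerD2l mulrC ler_pM2l//.
rewrite -opprB lerNr -ln_div ?posrE//.
have -> : k%:R / k.+1%:R = 1 + - k.+1%:R^-1 :> R.
  apply: (mulIf (x := k.+1%:R)); first by rewrite pnatr_eq0.
  by rewrite divfK ?pnatr_eq0// mulrDl mulNr mulVf ?pnatr_eq0// -natr1; ring.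
by apply: le_ln1Dx; rewrite ltrN2 invf_lt1// ltr1n.
Qed.

(** With [e = 1 - alpha], k^alpha / k^2 = k^(-1-e), so the tail telescopes against [W]. *)
Lemma powR_growth_summable (alpha : R) (x : nat -> R) K : alpha < 1 ->
  (forall k, 0 <= x k) -> (forall k, (K <= k)%N -> x k <= k%:R `^ alpha) ->
  exists C, forall N, \sum_(0 <= m < N) x m / m.+1%:R ^+ 2 <= C.
Proof.
move=> alpha1 x0 xK; pose e := 1 - alpha.
have e0 : 0 < e by rewrite subr_gt0.
pose W k := e^-1 * expR (- e * ln k%:R).
have W0 k : 0 <= W k by rewrite mulr_ge0 ?invr_ge0 ?ltW ?expR_gt0.
have step k : (0 < k)%N -> (K <= k.+1)%N -> x k.+1 / k.+2%:R ^+ 2 <= W k - W k.+1.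
  move=> k0 Kk; rewrite /W -mulrBr; apply: le_trans (telescoping_power_le e0 k0).
  have k1 : 0 < k.+1%:R :> R by [].
  apply: (@le_trans _ _ (k.+1%:R `^ alpha / k.+1%:R ^+ 2)).
    apply: ler_pM; rewrite ?invr_ge0 ?exprn_ge0//; first exact: xK.
    by rewrite lef_pV2 ?posrE ?exprn_gt0// lerXn2r ?nnegrE// ler_nat.
  rewrite /powR gt_eqF//.
  have -> : alpha * ln k.+1%:R = ln k.+1%:R + - e * ln k.+1%:R by rewrite /e; ring.
  by rewrite expRD lnK ?posrE// expr2 invfM mulrAC mulrA divff ?gt_eqF// mul1r mulrC.
(* Starting at [K.+2] ensures both side conditions of [step], including a positive index where the
   logarithm is taken. *)
pose J := K.+2; pose S N := \sum_(0 <= m < N) x m / m.+1%:R ^+ 2.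
have bound d : S (J + d)%N <= S J + W J.-1 - W (J + d).-1.
  elim: d => [|d IH]; first by rewrite addn0 addrK.
  have Kd : (K <= (K + d).+2)%N by rewrite -!addSn (leq_trans (leqnSn _))// leqW// leq_addr.
  rewrite addnS {1}/S big_nat_recr//= -/(S _).
  apply: le_trans (lerD IH (step (K + d).+1 isT Kd)) _.
  by rewrite addrA subrK.
exists (S J + W J.-1) => N; apply: (@le_trans _ _ (S (J + N)%N)).
  rewrite /S (big_cat_nat (n := N) (p := J + N))//= ?leq_addl// lerDl sumr_ge0// => m _.
  by rewrite mulr_ge0// invr_ge0 exprn_ge0.
by apply: le_trans (bound N) _; rewrite lerBlDr lerDl.
Qed.

(** The little-o is taken with constant 1, and the moduli are moved to [R] as real parts. *)
Lemma growth_summable (b : nat -> R[i]) (alpha : R) : alpha < 1 ->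
  b =o_\oo (fun k : nat => (k%:R `^ alpha)%:C) ->
  exists C, forall N, \sum_(0 <= m < N) `|b m| / m.+1%:R ^+ 2 <= C.
Proof.
move=> alpha1 /eqoP /(_ 1 ltr01) [K _ bK].
pose x k := complex.Re `|b k|.
have bx k : `|b k| = (x k)%:C by rewrite RRe_real// normr_real.
have powR_norm k : `|(k%:R `^ alpha)%:C| = (k%:R `^ alpha)%:C :> R[i].
  by rewrite ger0_norm// ler0c powR_ge0.
have [||C HC] := @powR_growth_summable alpha x K alpha1.
- by move=> k; rewrite -ler0c -bx.
- by move=> k /bK /=; rewrite mul1r powR_norm bx lecR.
exists C%:C => N; apply: (@le_trans _ _ (\sum_(0 <= m < N) x m / m.+1%:R ^+ 2)%:C).
  rewrite rmorph_sum; apply: ler_sum => m _.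
  by rewrite bx rmorphM fmorphV rmorphXn rmorph_nat.
by rewrite lecR.
Qed.

(** From k^alpha <= k for k >= 1; this kills the leftover terms in [barF1_cvg]. *)
Lemma growth_div_cvg0 (b : nat -> R[i]) (alpha : R) : alpha < 1 ->
  b =o_\oo (fun k : nat => (k%:R `^ alpha)%:C) ->
  (fun k => b k / k%:R) @ \oo --> (0 : R[i]).
Proof.
move=> alpha1 /eqoP bo; apply/cvgrPdist_le => e e0.
have [K _ bK] := bo e e0; exists K.+1 => //= k Kk.
have k0 : (0 < k)%N by apply: leq_trans Kk.
rewrite sub0r normrN normrM normfV [`|k%:R|]ger0_norm ?ler0n//.
have bk : `|b k| <= e * `|(k%:R `^ alpha)%:C| := bK k (ltnW Kk).
rewrite ler_pdivrMr ?ltr0n//. apply: le_trans bk _.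
rewrite ler_wpM2l ?(ltW e0)// ger0_norm ?ler0c ?powR_ge0//.
have -> : k%:R = (k%:R : R)%:C by rewrite rmorph_nat.
rewrite lecR -[leRHS]powRr1//.
by rewrite ler_powR ?ler1n// ltW.
Qed.
End Complex.

(** * Taylor expansion of [Psi] and of its derivatives about [n] *)

Theorem theorem2p2 (R : realType) (a : int -> R[i]) (alpha : R)
    (halpha : alpha < 1) (ha : growth_condition a alpha)
    (p n : nat) (hp : (0 < p)%N) (hn : (0 < n)%N)
    (s : R[i]) (hs : `|s + n%:R| < 1) :
  let u (j : nat) : R[i] :=
    'C(j + p - 2, p - 1)%:R * barM a n (j + p - 1) * (s + n%:R) ^+ (j - 1) in
  cvgn (fun N : nat => \sum_(1 <= j < N) u j) /\
  derive1n (p - 1) (Psi a) (- s) / (p - 1)`!%:R = (-1) ^+ p * \sum_(1 <= j <oo) u j.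
Proof.
case: p hp => // m _ u; have abs_cvg := @abs_cvg_complex R.
pose b k := a k%:Z.
have [C bC] := growth_summable halpha ha.1.
have b0 := growth_div_cvg0 halpha ha.1.
pose M := barM a n.
(* The index k - (n-1) - 1 is k - n, so [barE] is the negative-index part of [barF]. *)
have barEE j : barE a n.-1 j = \sum_(1 <= k < n) a (k%:Z - n%:Z) / k%:R ^+ j.
  rewrite /barE prednK//; apply: eq_bigr => k _.
  by rewrite -addrA -opprD -PoszD addn1 prednK.
have M1 : (fun N => \sum_(0 <= m < N) b m / (m + n)%:R - \sum_(0 <= m < N) b m / m%:R)
    @ \oo --> M 1%N.
  have Q := first_moment_cvg abs_cvg hn bC.
  suff -> : M 1%N = limn (fun N => \sum_(0 <= m < N) b m / (m + n)%:R
                                 - \sum_(0 <= m < N) b m / m%:R) by [].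
  have := lim_eq (barF1_cvg hn b0 Q); rewrite /M /barM /barF eqxx barEE => ->.
  by rewrite addrK.
have M2 j : (1 < j)%N ->
    (fun N => \sum_(0 <= m < N) b m / (m + n)%:R ^+ j) @ \oo --> M j.
  move=> j1; have [Q _] := moment_cvg abs_cvg hn bC j1.
  suff -> : M j = limn (fun N => \sum_(0 <= m < N) b m / (m + n)%:R ^+ j) by [].
  have := lim_eq (barF_cvg hn Q); rewrite /M /barM /barF gtn_eqF// barEE => ->.
  by rewrite addrK.
pose c i := - (-1) ^+ i * M i.+1.
(* Bounded coefficients are the case [q = 0]; [M 1] is added separately since [C] bounds only the
   moments of order at least 2. *)
have cb : binomially_bounded c.
  have C0 : 0 <= C by have := bC 0%N; rewrite big_geq.
  exists (`|M 1%N| + C), 0%N; split; first by rewrite addr_ge0.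
  move=> i; rewrite bin0 mulr1 /c normrM normrN normrX normrN1 expr1n mul1r.
  case: i => [|i]; first by rewrite lerDl.
  have [Q MC] := moment_cvg abs_cvg hn bC (isT : 1 < i.+2)%N.
  by rewrite -(lim_eq (M2 i.+2 isT)); apply: le_trans MC _; rewrite lerDr.
have PsiE z : `|z - n%:R| < 1 -> Psi a z = pseries_sum c (z - n%:R).
  move=> z1; rewrite -(digamma_expansion abs_cvg hn bC z1 M1 M2) /Psi.
  by rewrite [n%:R + _]addrC subrK opprK.
have s1 : `|- s - n%:R| < 1 by rewrite -opprD normrN.
have D := derive1n_pseries_sum abs_cvg m cb PsiE s1.
have S := pseries_cvg abs_cvg (binomially_bounded_iter m cb) s1.
(* The sign of [c (i + m)] is -(-1)^(i+m), and the base point -(s+n) gives (-1)^i; together they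
   leave (-1)^(m+1), which the prefactor cancels. The m! of [dcoef_iter] cancels as well, leaving
   the binomial. *)
have uS : (fun N => \sum_(1 <= j < N) u j) @ \oo -->
    (-1) ^+ m.+1 / m`!%:R * pseries_sum (iter m (@dcoef _) c) (- s - n%:R).
  apply: (cvg_scaled_shiftS S) => N; rewrite big_add1 /= mulr_sumr.
  apply: eq_bigr => i _; rewrite dcoef_iter /u /c -/M.
  rewrite !subn1 subn2 addSn addnS /= -[- s - _]opprD [(- (_ + _)) ^+ i]exprNn.
  rewrite -[_ *+ (_ * _)]mulr_natr natrM exprD exprS.
  have m0 : m`!%:R != 0 :> R[i] by rewrite pnatr_eq0 -lt0n fact_gt0.
  have si : (-1) ^+ i * (-1) ^+ i = 1 :> R[i] by rewrite -expr2 sqrr_sign.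
  have sm : (-1) ^+ m * (-1) ^+ m = 1 :> R[i] by rewrite -expr2 sqrr_sign.
  transitivity (((-1) ^+ i * (-1) ^+ i) * ((-1) ^+ m * (-1) ^+ m) * (m`!%:R / m`!%:R)
     * ('C(i + m, m)%:R * M (i + m).+1 * (s + n%:R) ^+ i)).
    by rewrite si sm divff// !mul1r.
  ring.
split; first exact: cvgP uS.
rewrite subn1 D.
rewrite (lim_eq uS) mulrA mulrA -expr2 sqrr_sign mul1r mulrC.
by congr (_ * _).
Qed.
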